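(* Let $M$ be a Riemannian manifold with $\dim(M)=3$ and let $v$ be a vector field on $M$. Then the intrinsic Ricci tensor $\widehat{\mathrm{Ric}^v}$ of the connection $\nabla^v$ admits the expression $$\widehat{\mathrm{Ric}^v}=\mathrm{Ric}^0+2\,v\otimes v+2\,\nabla^{0,s}v,$$ where $\nabla^{0,s}v$ denotes the symmetric part of $\nabla^0v$; that is, $\widehat{\mathrm{Ric}^v}(X)=\mathrm{Ric}^0(X)+2\langle X,v\rangle v+2\nabla^{0,s}_Xv$ for every vector field $X$.
   Context: $\nabla^0$ is the Levi-Civita connection and $\mathrm{Ric}^0$ its Ricci tensor (as an endomorphism). $\langle\nabla^{0,s}_Xv,Y\rangle=\frac12(\langle\nabla^0_Xv,Y\rangle+\langle\nabla^0_Yv,X\rangle)$. On an $n$-dimensional Riemannian manifold, $\nabla^v_XY=\nabla^0_XY-\frac{2}{n-1}K_v(X,Y)$ with $K_v(X,Y)=\langle Y,v\rangle X-\langle X,Y\rangle v$ (here $n=3$). Its torsion is $T^v(X,Y)=\nabla^v_XY-\nabla^v_YX-[X,Y]$, its curvature $R^v(X,Y)Z=\nabla^v_X\nabla^v_YZ-\nabla^v_Y\nabla^v_XZ-\nabla^v_{[X,Y]}Z$, and $\mathrm{Ric}^v(X)=\sum_{i}R^v(X,e_i)e_i$ for a local orthonormal frame $(e_i)$. The intrinsic Ricci tensor is $$\widehat{\mathrm{Ric}^v}(X)=\mathrm{Ric}^v(X)+\sum_{i=1}^n(\nabla^v_{e_i}T^v)(X,e_i).$$ *)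

(* Defs.v *)
From HB Require Import structures.
From mathcomp Require Import all_boot all_order all_algebra.
From mathcomp Require Import all_classical all_reals all_analysis.
From mathcomp Require Import ring.

Set Implicit Arguments.
Unset Strict Implicit.
Unset Printing Implicit Defensive.

Import Order.TTheory GRing.Theory Num.Theory.
Import numFieldNormedType.Exports.

Local Open Scope classical_set_scope.
Local Open Scope ring_scope.

(* [class_C k A f]: all partial derivatives of [f] of order at most [k] exist
   and are continuous on the open set [A]. *)
Fixpoint class_C (R : realType) (n k : nat) (A : set 'rV[R]_n)
    (f : 'rV[R]_n -> R^o) : Prop :=
  (forall x, A x -> {for x, continuous f}) /\
  (if k is k'.+1 then
     forall i : 'I_n,
       (forall x, A x -> derivable f x (delta_mx 0 i)) /\
       class_C k' A (fun x => 'D_(delta_mx 0 i) f x)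
   else True).

Definition smooth_on (R : realType) (n : nat) (A : set 'rV[R]_n)
    (f : 'rV[R]_n -> R^o) : Prop := forall k, class_C k A f.

Section smooth_on_theory.
Variables (R : realType) (n : nat) (A : set 'rV[R]_n).
Hypothesis oA : open A.
Implicit Types f g : 'rV[R]_n -> R^o.

Lemma class_C_cont k f : class_C k A f ->
  forall x, A x -> {for x, continuous f}.
Proof. by case: k => [|k] []. Qed.

Lemma class_CS k f : class_C k.+1 A f -> class_C k A f.
Proof.
elim: k f => [|k IH] f [cf df]; first by split.
split=> // i; have [di Ci] := df i; split=> //; exact: IH.
Qed.

Lemma class_C_eq k f g : (forall x, A x -> f x = g x) ->
  class_C k A f -> class_C k A g.
Proof.
have nfg f' g' x : (forall x, A x -> f' x = g' x) -> A x ->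
    \forall y \near x, f' y = g' y.
  move=> fg Ax; have := open_nbhs_nbhs (conj oA Ax).
  by apply: filterS => y; exact: fg.
have ncont (f' g' : 'rV[R]_n -> R^o) x : (forall x, A x -> f' x = g' x) ->
    A x -> {for x, continuous f'} -> {for x, continuous g'}.
  move=> fg Ax; rewrite /prop_for /continuous_at -(fg x Ax) => cf.
  exact: cvg_trans (near_eq_cvg (nfg _ _ _ fg Ax)) cf.
elim: k f g => [|k IH] f g fg [cf df]; split.
- by move=> x Ax; apply: ncont fg Ax (cf x Ax).
- by [].
- by move=> x Ax; apply: ncont fg Ax (cf x Ax).
- move=> i; have [di Ci] := df i; split.
    by move=> x Ax; apply: near_eq_derivable (di x Ax); exact: nfg fg Ax.
  by apply: IH Ci => x Ax; apply: near_eq_derive; exact: nfg fg Ax.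
Qed.

Lemma class_C_cst k (a : R) : class_C k A (cst a).
Proof.
elim: k a => [|k IH] a; first by split=> // x _; exact: cst_continuous.
split=> [x _|i]; first exact: cst_continuous.
split=> [x _|]; first exact: derivable_cst.
by apply: class_C_eq (IH 0) => x _; rewrite derive_cst.
Qed.

Lemma class_CD k f g : class_C k A f -> class_C k A g -> class_C k A (f + g).
Proof.
elim: k f g => [|k IH] f g [cf df] [cg dg].
  by split=> // x Ax; apply: continuousD; [exact: cf|exact: cg].
split=> [x Ax|i]; first by apply: continuousD; [exact: cf|exact: cg].
have [df1 df2] := df i; have [dg1 dg2] := dg i; split=> [x Ax|].
  by apply: derivableD; [exact: df1|exact: dg1].
apply: class_C_eq (IH _ _ df2 dg2) => x Ax.
by rewrite deriveD; [|exact: df1|exact: dg1].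
Qed.

Lemma class_CM k f g : class_C k A f -> class_C k A g -> class_C k A (f * g).
Proof.
elim: k f g => [|k IH] f g Cf Cg.
  by split=> // x Ax; apply: continuousM; [exact: (class_C_cont Cf)
    |exact: (class_C_cont Cg)].
split=> [x Ax|i].
  by apply: continuousM; [exact: (class_C_cont Cf)|exact: (class_C_cont Cg)].
have [df1 df2] := Cf.2 i; have [dg1 dg2] := Cg.2 i; split=> [x Ax|].
  by apply: derivableM; [exact: df1|exact: dg1].
apply: class_C_eq (class_CD (IH _ _ (class_CS Cf) dg2)
                            (IH _ _ (class_CS Cg) df2)) => x Ax.
by rewrite deriveM; [|exact: df1|exact: dg1].
Qed.

End smooth_on_theory.

Record chart (R : realType) (n : nat) (M : topologicalType) := Chart {
  dom : set M ;
  coord : M -> 'rV[R]_n ;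
  param : 'rV[R]_n -> M ;
  dom_open : open dom ;
  codom_open : open (coord @` dom) ;
  coordK : forall p, dom p -> param (coord p) = p ;
  coord_continuous : {within dom, continuous coord} ;
  param_continuous : {within coord @` dom, continuous param} }.

Record manifold (R : realType) (n : nat) := Manifold {
  carrier :> topologicalType ;
  atlas : set (chart R n carrier) ;
  hausdorff : hausdorff_space carrier ;
  countable_basis : @second_countable carrier ;
  atlas_cover : forall p : carrier, exists2 c, atlas c & dom c p ;
  atlas_compatible : forall c d, atlas c -> atlas d -> forall i : 'I_n,
    smooth_on (coord c @` (dom c `&` dom d))
              (fun x => coord d (param c x) ord0 i) }.

Definition smooth (R : realType) (n : nat) (M : manifold R n)
    (f : M -> R^o) : Prop :=
  forall c, atlas c -> smooth_on (coord c @` dom c) (f \o param c).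

Section smooth_functions.
Variables (R : realType) (n : nat) (M : manifold R n).

Definition smooth_pred : {pred M -> R^o} := fun f => `[< smooth f >].

Lemma smooth_cst (a : R) : smooth (cst a : M -> R^o).
Proof. by move=> c _ k; apply: class_C_cst; exact: codom_open. Qed.

Lemma smoothD (f g : M -> R^o) : smooth f -> smooth g -> smooth (f + g).
Proof.
move=> sf sg c ac k.
by apply: class_C_eq (class_CD _ (sf c ac k) (sg c ac k)) => //;
  exact: codom_open.
Qed.

Lemma smoothM (f g : M -> R^o) : smooth f -> smooth g -> smooth (f * g).
Proof.
move=> sf sg c ac k.
by apply: class_C_eq (class_CM _ (sf c ac k) (sg c ac k)) => //;
  exact: codom_open.
Qed.

Lemma smoothZ (a : R) (f : M -> R^o) : smooth f -> smooth (a *: f).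
Proof. by move=> sf; exact: (smoothM (smooth_cst a) sf). Qed.

Lemma smoothB (f g : M -> R^o) : smooth f -> smooth g -> smooth (f - g).
Proof. by move=> sf sg; rewrite -scaleN1r; apply/smoothD/smoothZ. Qed.

Lemma smooth_subring_closed : subring_closed smooth_pred.
Proof.
split=> [|f g /asboolP sf /asboolP sg|f g /asboolP sf /asboolP sg];
  apply/asboolP.
- exact: smooth_cst.
- exact: smoothB.
- exact: smoothM.
Qed.

Lemma smooth_submod_closed : submod_closed smooth_pred.
Proof.
split=> [|a f g /asboolP sf /asboolP sg]; apply/asboolP.
  exact: smooth_cst.
by apply/smoothD => //; exact: smoothZ.
Qed.

Record Cinf := MkCinf { Cinf_fun :> M -> R^o ; _ : smooth_pred Cinf_fun }.

HB.instance Definition _ := [isSub for Cinf_fun].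
HB.instance Definition _ := [Choice of Cinf by <:].
HB.instance Definition _ :=
  GRing.SubChoice_isSubComPzRing.Build (M -> R^o) smooth_pred Cinf
    smooth_subring_closed.
HB.instance Definition _ :=
  GRing.SubZmodule_isSubLmodule.Build R (M -> R^o) smooth_pred Cinf
    smooth_submod_closed.

Lemma CinfP (f : Cinf) : smooth f.
Proof. by case: f => f /= /asboolP. Qed.

Definition mkCinf (f : M -> R^o) (sf : smooth f) : Cinf :=
  MkCinf (asboolT sf).

Definition Cinf_cst (a : R) : Cinf := mkCinf (smooth_cst a).

End smooth_functions.

(* The tangent space at [p] consists of the derivations of [Cinf M] at [p]. *)
Section tangent_space.
Variables (R : realType) (n : nat) (M : manifold R n) (p : M).

Definition derivation_at (D : Cinf M -> R^o) : Prop :=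
  [/\ forall f g, D (f + g) = D f + D g,
      forall (a : R) f, D (a *: f) = a * D f
    & forall f g, D (f * g) = f p * D g + g p * D f].

Definition tangent_pred : {pred Cinf M -> R^o} :=
  fun D => `[< derivation_at D >].

Lemma tangent_submod_closed : submod_closed tangent_pred.
Proof.
split=> [|a D E /asboolP[D1 D2 D3] /asboolP[E1 E2 E3]]; apply/asboolP; split.
- by move=> f g; change (0 = 0 + 0 :> R); rewrite addr0.
- by move=> b f; change (0 = b * 0 :> R); rewrite mulr0.
- by move=> f g; change (0 = f p * 0 + g p * 0 :> R); rewrite !mulr0 addr0.
- move=> f g; change (a * D (f + g) + E (f + g) =
    (a * D f + E f) + (a * D g + E g) :> R).
  by rewrite D1 E1 mulrDr addrACA.
- move=> b f; change (a * D (b *: f) + E (b *: f) =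
    b * (a * D f + E f) :> R).
  by rewrite D2 E2 mulrDr mulrCA.
- move=> f g; change (a * D (f * g) + E (f * g) =
    f p * (a * D g + E g) + g p * (a * D f + E f) :> R).
  by rewrite D3 E3 !mulrDr addrACA ![a * (_ * _)]mulrCA.
Qed.

Record tangent := MkTangent {
  tangent_fun :> Cinf M -> R^o ; _ : tangent_pred tangent_fun }.

HB.instance Definition _ := [isSub for tangent_fun].
HB.instance Definition _ := [Choice of tangent by <:].
HB.instance Definition _ :=
  GRing.SubChoice_isSubLmodule.Build R (Cinf M -> R^o) tangent_pred tangent
    tangent_submod_closed.

Lemma tangentP (w : tangent) : derivation_at w.
Proof. by case: w => w /= /asboolP. Qed.

Definition mkTangent (D : Cinf M -> R^o) (dD : derivation_at D) : tangent :=
  MkTangent (asboolT dD).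

Lemma tangentD (w w' : tangent) f : (w + w') f = w f + w' f.
Proof. by []. Qed.

Lemma tangentZ (a : R) (w : tangent) f : (a *: w) f = a * w f.
Proof. by []. Qed.

Lemma tangentN (w : tangent) f : (- w) f = - w f.
Proof. by []. Qed.

End tangent_space.

Section vector_fields.
Variables (R : realType) (n : nat) (M : manifold R n).

Definition smooth_section (X : forall p : M, tangent p) : Prop :=
  forall f : Cinf M, smooth (fun p => X p f).

Definition vfield_pred : {pred forall p : M, tangent p} :=
  fun X => `[< smooth_section X >].

Record vfield := MkVfield {
  vfield_fun :> forall p : M, tangent p ; _ : vfield_pred vfield_fun }.

HB.instance Definition _ := [isSub for vfield_fun].
HB.instance Definition _ := [Choice of vfield by <:].

Lemma vfieldP (X : vfield) : smooth_section X.
Proof. by case: X => X /= /asboolP. Qed.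

Definition mkVfield (X : forall p, tangent p) (sX : smooth_section X) :
  vfield := MkVfield (asboolT sX).

Lemma vfield_eq (X Y : vfield) : (forall p, X p = Y p) -> X = Y.
Proof. by move=> XY; apply/val_inj/functional_extensionality_dep. Qed.

Lemma smooth_section0 : smooth_section (fun=> 0).
Proof. by move=> f; exact: smooth_cst. Qed.

Lemma smooth_sectionD (X Y : vfield) : smooth_section (fun p => X p + Y p).
Proof. by move=> f; exact: smoothD (vfieldP X f) (vfieldP Y f). Qed.

Lemma smooth_sectionN (X : vfield) : smooth_section (fun p => - X p).
Proof.
move=> f; have := smoothZ (-1) (vfieldP X f); congr smooth.
by apply/funext => p; rewrite tangentN fctE scaleN1r.
Qed.

Lemma smooth_sectionZ (h : Cinf M) (X : vfield) :
  smooth_section (fun p => (h p : R) *: X p).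
Proof. by move=> f; exact: smoothM (CinfP h) (vfieldP X f). Qed.

Definition vzero : vfield := mkVfield smooth_section0.
Definition vadd (X Y : vfield) : vfield := mkVfield (smooth_sectionD X Y).
Definition vopp (X : vfield) : vfield := mkVfield (smooth_sectionN X).
Definition vscale (h : Cinf M) (X : vfield) : vfield :=
  mkVfield (smooth_sectionZ h X).

Lemma vaddA : associative vadd.
Proof. by move=> X Y Z; apply: vfield_eq => p; exact: addrA. Qed.
Lemma vaddC : commutative vadd.
Proof. by move=> X Y; apply: vfield_eq => p; exact: addrC. Qed.
Lemma vadd0 : left_id vzero vadd.
Proof. by move=> X; apply: vfield_eq => p; exact: add0r. Qed.
Lemma vaddN : left_inverse vzero vopp vadd.
Proof. by move=> X; apply: vfield_eq => p; exact: addNr. Qed.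

HB.instance Definition _ := GRing.isZmodule.Build vfield vaddA vaddC vadd0 vaddN.

Lemma vscaleA a b X : vscale a (vscale b X) = vscale (a * b) X.
Proof. by apply: vfield_eq => p; exact: scalerA. Qed.
Lemma vscale1 : left_id 1 vscale.
Proof. by move=> X; apply: vfield_eq => p; exact: scale1r. Qed.
Lemma vscaleDr : right_distributive vscale +%R.
Proof. by move=> a X Y; apply: vfield_eq => p; exact: scalerDr. Qed.
Lemma vscaleDl X : {morph vscale^~ X : a b / a + b}.
Proof. by move=> a b; apply: vfield_eq => p; exact: scalerDl. Qed.

HB.instance Definition _ :=
  GRing.Zmodule_isLmodule.Build (Cinf M) vfield
    vscaleA vscale1 vscaleDr vscaleDl.

Definition vderiv (X : vfield) (f : Cinf M) : Cinf M := mkCinf (vfieldP X f).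

Lemma bracket_derivation (X Y : vfield) p :
  derivation_at p (fun f => X p (vderiv Y f) - Y p (vderiv X f)).
Proof.
have vD (Z : vfield) f g : vderiv Z (f + g) = vderiv Z f + vderiv Z g.
  by apply/val_inj/funext => q; have [+ _ _] := tangentP (Z q); exact.
have vZ (Z : vfield) a f : vderiv Z (a *: f) = a *: vderiv Z f.
  by apply/val_inj/funext => q; have [_ + _] := tangentP (Z q); exact.
have vM (Z : vfield) f g :
    vderiv Z (f * g) = f * vderiv Z g + g * vderiv Z f.
  by apply/val_inj/funext => q; have [_ _ +] := tangentP (Z q); exact.
have [X1 X2 X3] := tangentP (X p); have [Y1 Y2 Y3] := tangentP (Y p).
split=> [f g|a f|f g].
- by rewrite !vD X1 Y1 opprD addrACA.
- by rewrite !vZ X2 Y2 mulrBr.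
by rewrite !vM X1 Y1 !X3 !Y3 /=; ring.
Qed.

Definition bracket_at (X Y : vfield) (p : M) : tangent p :=
  mkTangent (bracket_derivation X Y p).

Lemma smooth_bracket (X Y : vfield) : smooth_section (bracket_at X Y).
Proof.
move=> f.
exact: smoothB (vfieldP X (vderiv Y f)) (vfieldP Y (vderiv X f)).
Qed.

Definition bracket (X Y : vfield) : vfield := mkVfield (smooth_bracket X Y).

End vector_fields.

Section connections.
Variables (R : realType) (n : nat) (M : manifold R n).
Implicit Types (X Y Z : vfield M) (nabla : vfield M -> vfield M -> vfield M).

(* R-linearity in the second argument follows from additivity and the Leibniz
   rule for constant functions. *)
Definition is_connection nabla : Prop :=
  [/\ forall (f : Cinf M) X X' Y,
        nabla (f *: X + X') Y = f *: nabla X Y + nabla X' Y,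
      forall X Y Y', nabla X (Y + Y') = nabla X Y + nabla X Y'
    & forall X (f : Cinf M) Y,
        nabla X (f *: Y) = vderiv X f *: Y + f *: nabla X Y].

Definition torsion nabla X Y : vfield M :=
  nabla X Y - nabla Y X - bracket X Y.

(* [nabla_torsion nabla Z X Y] is (nabla_Z T)(X, Y). *)
Definition nabla_torsion nabla Z X Y : vfield M :=
  nabla Z (torsion nabla X Y) - torsion nabla (nabla Z X) Y
    - torsion nabla X (nabla Z Y).

Definition curvature nabla X Y Z : vfield M :=
  nabla X (nabla Y Z) - nabla Y (nabla X Z) - nabla (bracket X Y) Z.

(* When [e] restricts to an orthonormal frame on [U], the vector fields
   [ricci nabla e X] and [intrinsic_ricci nabla e X] are the (intrinsic) Ricci
   endomorphism applied to [X] on [U]; outside [U] they mean nothing. *)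
Definition ricci nabla (e : 'I_n -> vfield M) X : vfield M :=
  \sum_i curvature nabla X (e i) (e i).

Definition intrinsic_ricci nabla (e : 'I_n -> vfield M) X : vfield M :=
  ricci nabla e X + \sum_i nabla_torsion nabla (e i) X (e i).

End connections.

Record metric (R : realType) (n : nat) (M : manifold R n) := Metric {
  inner :> forall p : M, tangent p -> tangent p -> R ;
  inner_linear : forall p (a : R) (u u' w : tangent p),
    inner (a *: u + u') w = a * inner u w + inner u' w ;
  inner_sym : forall p (u w : tangent p), inner u w = inner w u ;
  inner_gt0 : forall p (u : tangent p), u != 0 -> 0 < inner u u ;
  inner_smooth : forall X Y : vfield M,
    smooth (fun p => inner (X p) (Y p) : R^o) }.

Section riemannian.
Variables (R : realType) (n : nat) (M : manifold R n) (g : metric M).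
Implicit Types (v X Y Z : vfield M).
Implicit Types (nabla : vfield M -> vfield M -> vfield M).

Definition inner_fun X Y : Cinf M := mkCinf (inner_smooth g X Y).

Definition is_levi_civita nabla : Prop :=
  [/\ is_connection nabla,
      forall X Y, torsion nabla X Y = 0
    & forall X Y Z, vderiv X (inner_fun Y Z) =
        inner_fun (nabla X Y) Z + inner_fun Y (nabla X Z)].

(* A local orthonormal frame on the open set [U], represented by vector fields
   on [M]: every local frame is of this form after shrinking [U], by
   multiplication with a cutoff function. *)
Definition orthonormal_frame (U : set M) (e : 'I_n -> vfield M) : Prop :=
  [/\ open U,
      forall p, U p -> forall i j, g p (e i p) (e j p) = (i == j)%:R
    & forall p, U p -> forall w : tangent p,
        exists a : 'I_n -> R, w = \sum_i a i *: e i p].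

Definition K_tensor v X Y : vfield M :=
  inner_fun Y v *: X - inner_fun X Y *: v.

Definition nabla_vec nabla0 v X Y : vfield M :=
  nabla0 X Y - Cinf_cst M (2 / (n%:R - 1)) *: K_tensor v X Y.

(* [S] is the symmetric part of [nabla v]; as [g] is nondegenerate, the
   equation determines [S]. *)
Definition is_symmetric_part nabla v (S : vfield M -> vfield M) : Prop :=
  forall X Y p, g p (S X p) (Y p) =
    2^-1 * (g p (nabla X v p) (Y p) + g p (nabla Y v p) (X p)).

End riemannian.

(* Main.v *)
Require Import Defs.
From mathcomp Require Import all_boot all_order all_algebra.
From mathcomp Require Import all_classical all_reals all_analysis.
From mathcomp Require Import ring.

Local Open Scope classical_set_scope.
Local Open Scope ring_scope.

Set Implicit Arguments.
Unset Strict Implicit.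
Unset Printing Implicit Defensive.

Import GRing.Theory Num.Theory.

(** Write D for the connection [nabla_vec], which in dimension 3 is
    [D_X Y = nabla0_X Y - <Y, v> X + <X, Y> v].  It is again a metric
    connection, its torsion is [T(X, Y) = <X, v> Y - <Y, v> X], and hence
    [(D_Z T)(X, Y) = <X, D_Z v> Y - <Y, D_Z v> X].  Expanding the curvature of
    D as well, the parts along [X] and [Y] of the terms quadratic in [v] cancel
    in the sum
    [R^D(X, Y) Y + (D_Y T)(X, Y)
      = R^0(X, Y) Y + (<X, nabla0_Y v> - <Y, nabla0_X v>) Y
        + |Y|^2 (nabla0_X v + <X, v> v)
        - <X, Y> (nabla0_Y v + <Y, v> v)],
    an identity between arbitrary vector fields
    ([curvature_nabla_torsion_shift]).  It remains to put [Y = e_i] and to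
    sum over [i]: only the orthonormality of the frame at the point [p] is
    used, so no derivative of the functions [<e_i, e_j>] is needed.

    The sum contains [\sum_i <X, e_i> nabla0_(e_i) v], which is [nabla0_X v]
    because [nabla0_X v] at [p] depends linearly on [X p].  This
    tensoriality is read off from the symmetric part of [nabla0 v]
    ([nabla_frame]): the value [<S Y, X>] at [p] is visibly linear in [X p],
    and it differs from [<nabla0_X v, Y> / 2] by a term with the same
    property. *)

(** * Evaluation, inner products and connections *)

Section vfield_evaluation.
Variables (R : realType) (n : nat) (M : manifold R n).
Implicit Types (X Y Z : vfield M) (p : M) (f h : Cinf M).

Lemma vfield_ext X Y : (forall p f, X p f = Y p f :> R) -> X = Y.
Proof. by move=> XY; apply: vfield_eq => p; apply/val_inj/funext => f; exact: XY. Qed.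

Lemma Cinf_ext f h : (forall p, f p = h p :> R) -> f = h.
Proof. by move=> fh; apply/val_inj/funext => p; exact: fh. Qed.

Lemma vfieldD_at X Y p : (X + Y) p = X p + Y p. Proof. by []. Qed.
Lemma vfieldDE X Y p f : (X + Y) p f = X p f + Y p f :> R. Proof. by []. Qed.
Lemma vfieldNE X p f : (- X) p f = - X p f :> R. Proof. by []. Qed.
Lemma vfieldZE h X p f : (h *: X) p f = h p * X p f :> R. Proof. by []. Qed.
Lemma CinfDE h f p : (h + f) p = h p + f p :> R. Proof. by []. Qed.
Lemma CinfNE h p : (- h) p = - h p :> R. Proof. by []. Qed.
Lemma CinfME h f p : (h * f) p = h p * f p :> R. Proof. by []. Qed.

Definition vfieldE := (vfieldDE, vfieldNE, vfieldZE, CinfDE, CinfNE, CinfME).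

Lemma vfield_sum_at (I : finType) (F : I -> vfield M) p :
  (\sum_i F i) p = \sum_i F i p.
Proof. exact: (big_morph (fun X : vfield M => X p)). Qed.

End vfield_evaluation.

Section inner_product.
Variables (R : realType) (n : nat) (M : manifold R n) (g : metric M).
Implicit Types (X Y Z : vfield M) (h : Cinf M) (p : M).

Lemma innerDl p (u u' w : tangent p) : g p (u + u') w = g p u w + g p u' w.
Proof. by have := inner_linear g 1 u u' w; rewrite scale1r mul1r. Qed.

Lemma inner0l p (w : tangent p) : g p 0 w = 0.
Proof. by apply: (addrI (g p 0 w)); rewrite -innerDl !addr0. Qed.

Lemma innerZl p a (u w : tangent p) : g p (a *: u) w = a * g p u w.
Proof. by have := inner_linear g a u 0 w; rewrite inner0l !addr0. Qed.

Lemma inner_suml p (I : finType) (u : I -> tangent p) w :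
  g p (\sum_i u i) w = \sum_i g p (u i) w.
Proof.
exact: (big_morph (fun u => g p u w) (fun u u' => innerDl u u' w)
  (inner0l w)).
Qed.

Lemma inner_sumr p (I : finType) (u : I -> tangent p) w :
  g p w (\sum_i u i) = \sum_i g p w (u i).
Proof.
by rewrite inner_sym inner_suml; apply: eq_bigr => i _; rewrite inner_sym.
Qed.

Lemma inner_funC X Y : inner_fun g X Y = inner_fun g Y X.
Proof. by apply: Cinf_ext => p; exact: inner_sym. Qed.

Lemma inner_funDl X X' Y :
  inner_fun g (X + X') Y = inner_fun g X Y + inner_fun g X' Y.
Proof. by apply: Cinf_ext => p; exact: innerDl. Qed.

Lemma inner_funZl h X Y : inner_fun g (h *: X) Y = h * inner_fun g X Y.
Proof. by apply: Cinf_ext => p; exact: innerZl. Qed.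

Lemma inner_funNl X Y : inner_fun g (- X) Y = - inner_fun g X Y.
Proof. by rewrite -scaleN1r inner_funZl mulN1r. Qed.

Lemma inner_funDr X Y Y' :
  inner_fun g X (Y + Y') = inner_fun g X Y + inner_fun g X Y'.
Proof. by rewrite inner_funC inner_funDl !(inner_funC X). Qed.

Lemma inner_funZr h X Y : inner_fun g X (h *: Y) = h * inner_fun g X Y.
Proof. by rewrite inner_funC inner_funZl (inner_funC X). Qed.

Lemma inner_funNr X Y : inner_fun g X (- Y) = - inner_fun g X Y.
Proof. by rewrite inner_funC inner_funNl (inner_funC X). Qed.

Definition inner_funE := (inner_funDl, inner_funDr, inner_funNl, inner_funNr,
  inner_funZl, inner_funZr).

End inner_product.

Section connection_theory.
Variables (R : realType) (n : nat) (M : manifold R n).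
Variable nabla : vfield M -> vfield M -> vfield M.
Hypothesis nablaP : is_connection nabla.
Implicit Types (X Y Z : vfield M) (h : Cinf M).

Lemma connectionDl X X' Y : nabla (X + X') Y = nabla X Y + nabla X' Y.
Proof. by have [+ _ _] := nablaP => /(_ 1 X X' Y); rewrite !scale1r. Qed.

Lemma connectionNl X Y : nabla (- X) Y = - nabla X Y.
Proof.
have nabla0 : nabla 0 Y = 0.
  by apply: (addrI (nabla 0 Y)); rewrite -connectionDl !addr0.
by apply: (addrI (nabla X Y)); rewrite -connectionDl !subrr.
Qed.

Lemma connectionDr X Y Y' : nabla X (Y + Y') = nabla X Y + nabla X Y'.
Proof. by have [_ + _] := nablaP; exact. Qed.

Lemma connectionNr X Y : nabla X (- Y) = - nabla X Y.
Proof.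
have nabla0 : nabla X 0 = 0.
  by apply: (addrI (nabla X 0)); rewrite -connectionDr !addr0.
by apply: (addrI (nabla X Y)); rewrite -connectionDr !subrr.
Qed.

Lemma connectionZr X h Y : nabla X (h *: Y) = vderiv X h *: Y + h *: nabla X Y.
Proof. by have [_ _ +] := nablaP; exact. Qed.

Definition connectionE :=
  (connectionDl, connectionNl, connectionDr, connectionNr, connectionZr).

End connection_theory.

(** * The connection with vectorial torsion *)

Section vectorial_shift.
Variables (R : realType) (n : nat) (M : manifold R n) (g : metric M).
Variable nabla : vfield M -> vfield M -> vfield M.
Hypothesis nabla_LC : is_levi_civita g nabla.
Variable v : vfield M.
Implicit Types (X Y Z : vfield M) (h : Cinf M).

(** The connection [nabla_vec] with the factor [2 / (n - 1)] normalized to 1,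
    in any dimension; the two agree when [n = 3]. *)
Definition shift X Y : vfield M := nabla X Y - K_tensor g v X Y.

Let nablaP : is_connection nabla. Proof. by case: nabla_LC. Qed.

Lemma bracketE X Y : bracket X Y = nabla X Y - nabla Y X.
Proof.
by have [_ + _] := nabla_LC => /(_ X Y) /eqP; rewrite subr_eq0 => /eqP.
Qed.

Lemma vderiv_inner X Y Z : vderiv X (inner_fun g Y Z) =
  inner_fun g (nabla X Y) Z + inner_fun g Y (nabla X Z).
Proof. by have [_ _ +] := nabla_LC; exact. Qed.

Lemma shiftE X Y :
  shift X Y = nabla X Y - inner_fun g Y v *: X + inner_fun g X Y *: v.
Proof. by rewrite /shift /K_tensor opprB addrA addrAC. Qed.

Lemma shift_connection : is_connection shift.
Proof.
have [nl _ _] := nablaP.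
split=> [h X X' Y|X Y Y'|X h Y]; rewrite !shiftE ?nl ?(connectionE nablaP) //;
  rewrite !inner_funE; apply: vfield_ext => p f; rewrite !vfieldE; ring.
Qed.

Lemma shift_metric X Y Z : vderiv X (inner_fun g Y Z) =
  inner_fun g (shift X Y) Z + inner_fun g Y (shift X Z).
Proof.
rewrite vderiv_inner !shiftE !inner_funE.
rewrite (inner_funC _ Y X) (inner_funC _ v Z).
by apply: Cinf_ext => p; rewrite !vfieldE; ring.
Qed.

Lemma torsion_shift X Y :
  torsion shift X Y = inner_fun g X v *: Y - inner_fun g Y v *: X.
Proof.
rewrite /torsion bracketE !shiftE (inner_funC _ Y X).
by apply: vfield_ext => p f; rewrite !vfieldE; ring.
Qed.

Lemma nabla_torsion_shift Z X Y : nabla_torsion shift Z X Y =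
  inner_fun g X (shift Z v) *: Y - inner_fun g Y (shift Z v) *: X.
Proof.
rewrite /nabla_torsion !torsion_shift !(connectionE shift_connection).
rewrite !shift_metric.
by apply: vfield_ext => p f; rewrite !vfieldE; ring.
Qed.

Lemma curvature_shift X Y Z : curvature shift X Y Z =
  curvature nabla X Y Z
  - inner_fun g Z (nabla X v) *: Y + inner_fun g Y Z *: nabla X v
  + inner_fun g Z (nabla Y v) *: X - inner_fun g X Z *: nabla Y v
  + (K_tensor g v X (K_tensor g v Y Z) - K_tensor g v Y (K_tensor g v X Z)).
Proof.
rewrite /curvature bracketE !shiftE /K_tensor !(connectionE nablaP).
rewrite !inner_funE !vderiv_inner.
by apply: vfield_ext => p f; rewrite !vfieldE; ring.
Qed.

(** The summand of the intrinsic Ricci tensor, for an arbitrary vector field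
    in place of a frame vector. *)
Lemma curvature_nabla_torsion_shift X Y :
  curvature shift X Y Y + nabla_torsion shift Y X Y =
  curvature nabla X Y Y
  + ((inner_fun g X (nabla Y v) - inner_fun g Y (nabla X v)) *: Y
     + inner_fun g Y Y *: (nabla X v + inner_fun g X v *: v)
     - inner_fun g X Y *: (nabla Y v + inner_fun g Y v *: v)).
Proof.
rewrite curvature_shift nabla_torsion_shift shiftE /K_tensor !inner_funE.
rewrite (inner_funC _ Y X).
by apply: vfield_ext => p f; rewrite !vfieldE; ring.
Qed.

End vectorial_shift.

(** * Summation over an orthonormal frame *)

Section frame.
Variables (R : realType) (n : nat) (M : manifold R n) (g : metric M).
Variables (U : set M) (e : 'I_n -> vfield M) (p : M).
Hypotheses (e_frame : orthonormal_frame g U e) (Up : U p).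

Lemma frame_expansion (w : tangent p) : \sum_i g p w (e i p) *: e i p = w.
Proof.
have [_ /(_ p Up) ortho /(_ p Up w)[a ->]] := e_frame.
apply: eq_bigr => i _; congr (_ *: _).
rewrite inner_suml (bigD1 i) //= big1 => [|j ji].
  by rewrite innerZl ortho eqxx mulr1 addr0.
by rewrite innerZl ortho (negPf ji) mulr0.
Qed.

Lemma frame_ext (u w : tangent p) :
  (forall i, g p u (e i p) = g p w (e i p)) -> u = w.
Proof.
move=> uw; rewrite -(frame_expansion u) -(frame_expansion w).
by apply: eq_bigr => i _; rewrite uw.
Qed.

Lemma inner_frame (u w : tangent p) :
  g p u w = \sum_i g p u (e i p) * g p w (e i p).
Proof.
rewrite -[in LHS](frame_expansion w) inner_sumr; apply: eq_bigr => i _.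
by rewrite inner_sym innerZl (inner_sym g u) mulrC.
Qed.

Variables (nabla : vfield M -> vfield M -> vfield M) (v : vfield M).
Variable S : vfield M -> vfield M.
Hypothesis SP : is_symmetric_part g nabla v S.

Lemma symmetric_partE (X Y : vfield M) : 2 * g p (S X p) (Y p) =
  g p (nabla X v p) (Y p) + g p (nabla Y v p) (X p).
Proof. by rewrite SP mulrA divff ?mul1r ?pnatr_eq0. Qed.

(** Tensoriality of [nabla v] at [p], from the symmetric part alone. *)
Lemma nabla_frame (X : vfield M) :
  \sum_i g p (X p) (e i p) *: nabla (e i) v p = nabla X v p.
Proof.
apply: frame_ext => j; rewrite inner_suml.
(* After adding [<nabla_(e j) v, X>] both sides are [2 <S (e j), X>]: the
   right-hand side by definition, the left-hand side after expanding [X]. *)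
apply: (addrI (g p (nabla (e j) v p) (X p))).
rewrite -symmetric_partE (inner_frame _ (X p)) (inner_frame (S _ p)) mulr_sumr.
rewrite -big_split /=; apply: eq_bigr => i _.
by rewrite innerZl mulrA symmetric_partE mulrDl (mulrC (g p (X p) _)).
Qed.

Lemma symmetric_part_frame (X : vfield M) :
  2 *: S X p = nabla X v p + \sum_i g p (X p) (nabla (e i) v p) *: e i p.
Proof.
rewrite -[in RHS](frame_expansion (nabla X v p)) -big_split /=.
rewrite -[in LHS](frame_expansion (2 *: S X p)); apply: eq_bigr => i _.
by rewrite innerZl symmetric_partE scalerDl (inner_sym g (X p)).
Qed.

(** The intrinsic Ricci tensor of [shift] in any dimension; the last two terms
    are [(n - 2) nabla_X v] plus the transpose of [nabla v] applied to [X]. *)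
Lemma intrinsic_ricci_shift (nabla_LC : is_levi_civita g nabla)
    (X : vfield M) :
  intrinsic_ricci (shift g nabla v) e X p =
  ricci nabla e X p + ((n%:R - 1) * g p (X p) (v p)) *: v p
    + ((n%:R - 3) *: nabla X v p + 2 *: S X p).
Proof.
have [_ /(_ p Up) ortho _] := e_frame.
rewrite /intrinsic_ricci /ricci -big_split /=.
under eq_bigr => i _ do rewrite (curvature_nabla_torsion_shift nabla_LC).
rewrite big_split vfieldD_at -addrA; congr (_ + _).
rewrite vfield_sum_at.
set x := X p; set w := nabla X v p.
transitivity (\sum_i (g p x (nabla (e i) v p) *: e i p - g p w (e i p) *: e i p
    + (w + g p x (v p) *: v p)
    - (g p x (e i p) *: nabla (e i) v p
       + (g p x (e i p) * g p (v p) (e i p)) *: v p))).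
  apply: eq_bigr => i _; apply/val_inj/funext => f.
  change (((g p x (nabla (e i) v p) - g p (e i p) w) * e i p f
    + g p (e i p) (e i p) * (w f + g p x (v p) * v p f)
    - g p x (e i p) * (nabla (e i) v p f + g p (e i p) (v p) * v p f) : R) =
    g p x (nabla (e i) v p) * e i p f - g p w (e i p) * e i p f
    + (w f + g p x (v p) * v p f)
    - (g p x (e i p) * nabla (e i) v p f
       + (g p x (e i p) * g p (v p) (e i p)) * v p f)).
  rewrite ortho eqxx mulr1n (inner_sym g (e i p) w) (inner_sym g (e i p) (v p)).
  by ring.
rewrite !(big_split, sumrN) /= -!scaler_suml frame_expansion nabla_frame.
rewrite -inner_frame.
rewrite !sumr_const card_ord symmetric_part_frame -/w.
rewrite -scaler_nat -[g p x (v p) *+ n]mulr_natl.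
apply/val_inj/funext => f.
set s := (\sum_i g p x (nabla (e i) v p) *: e i p).
change (s f - w f + (n%:R * w f + n%:R * g p x (v p) * v p f)
  - (w f + g p x (v p) * v p f) =
  ((n%:R - 1) * g p x (v p)) * v p f + ((n%:R - 3) * w f + (w f + s f)) :> R).
by ring.
Qed.

End frame.

Lemma nabla_vec3 (R : realType) (M : manifold R 3) (g : metric M)
    (nabla : vfield M -> vfield M -> vfield M) (v : vfield M) :
  nabla_vec g nabla v = shift g nabla v.
Proof.
apply/funext => X; apply/funext => Y; congr (_ - _).
rewrite -[RHS]scale1r; congr (_ *: _); apply/val_inj/funext => p /=.
change (2 / (3%:R - 1) = 1 :> R).
by rewrite -(natrB R (isT : (1 <= 3)%N)) divff ?pnatr_eq0.
Qed.

Theorem theorem4p3 (R : realType) (M : manifold R 3) (g : metric M)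
    (nabla0 : vfield M -> vfield M -> vfield M)
    (nabla0_LC : is_levi_civita g nabla0)
    (v : vfield M)
    (nabla0s_v : vfield M -> vfield M)
    (nabla0s_vP : is_symmetric_part g nabla0 v nabla0s_v)
    (U : set M) (e : 'I_3 -> vfield M)
    (e_frame : orthonormal_frame g U e)
    (X : vfield M) (p : M) (Up : U p) :
  intrinsic_ricci (nabla_vec g nabla0 v) e X p =
    ricci nabla0 e X p + (2 * g p (X p) (v p)) *: v p + 2 *: nabla0s_v X p.
Proof.
rewrite nabla_vec3.
rewrite (intrinsic_ricci_shift e_frame Up nabla0s_vP nabla0_LC).
by rewrite subrr scale0r add0r -(natrB R (isT : (1 <= 3)%N)).
Qed.
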